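(* Let $k\ge1$ and $a\ge1$ be integers. Then $$\operatorname{vol}\mathcal F_{\mathrm{MCar}^{(k)}_{a+2}}(1,0,\ldots,0,-1)=\mathrm{Cat}(a,ka-1).$$
   Context: The $k$-multicaracol graph $\mathrm{MCar}^{(k)}_{a+2}$ is the directed multigraph on vertex set $\{0,1,\ldots,a+1\}$ whose edges are: $(i,i+1)$ for $1\le i\le a$, $(i,a+1)$ for $1\le i\le a-1$ (these form the Pitman--Stanley graph $\mathrm{PS}_{a+1}$ on $\{1,\ldots,a+1\}$), and $k$ distinct parallel edges $(0,i)$ for each $i=1,\ldots,a$; edges are directed from smaller to larger vertex. For a net flow vector $\mathbf a=(a_0,a_1,\ldots,a_a,-\sum a_i)$ with $a_i\ge0$ (indexed by the vertices), $\mathcal F_G(\mathbf a)$ is the set of $(f_e)_{e\in E}\in\mathbb R^E_{\ge0}$ (one coordinate per edge, parallel edges counted separately) such that at each vertex $j\le a$ the outflow minus the inflow equals $a_j$. The normalized volume of a $d$-dimensional polytope is $d!$ times its relative volume with respect to the integer lattice. $\mathrm{Cat}(a,b)=\frac1{a+b}\binom{a+b}{a}$. *)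

(* Defs.v *)
From HB Require Import structures.
From mathcomp Require Import all_boot all_order all_algebra.
From mathcomp Require Import all_classical all_reals all_analysis.

Set Implicit Arguments.
Unset Strict Implicit.
Unset Printing Implicit Defensive.

Import Order.TTheory GRing.Theory Num.Theory.

Local Open Scope classical_set_scope.
Local Open Scope ring_scope.

(** A directed multigraph on the vertices 0, ..., n: edges form a type of their
    own, so distinct edges may share both endpoints. *)
Record multidigraph (n : nat) := Multidigraph {
  edge : finType ;
  src : edge -> 'I_n.+1 ;
  tgt : edge -> 'I_n.+1 }.

Definition flow_polytope (R : realType) (n : nat) (G : multidigraph n)
    (netflow : 'I_n.+1 -> R) : set (edge G -> R) :=
  [set f | (forall e, 0 <= f e) /\
    forall j : 'I_n.+1, (j < n)%N ->
      \sum_(e : edge G | src e == j) f e - \sum_(e : edge G | tgt e == j) f e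
      = netflow j].

(** Ordinals start at 0, so the ordinal i stands for the index i + 1:
    - inl (inl i) is the edge (i+1, i+2), for 1 <= i+1 <= a;
    - inl (inr i) is the edge (i+1, a+1), for 1 <= i+1 <= a-1;
    - inr (i, m) is the m-th of the k parallel edges (0, i+1), 1 <= i+1 <= a. *)
Definition mcar_edge (k a : nat) : finType := ('I_a + 'I_a.-1 + 'I_a * 'I_k)%type.

Definition mcar_src (k a : nat) (e : mcar_edge k a) : 'I_a.+2 :=
  match e with
  | inl (inl i) => inord i.+1
  | inl (inr i) => inord i.+1
  | inr _ => ord0
  end.

Definition mcar_tgt (k a : nat) (e : mcar_edge k a) : 'I_a.+2 :=
  match e with
  | inl (inl i) => inord i.+2
  | inl (inr _) => ord_max
  | inr (i, _) => inord i.+1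
  end.

Definition MCar (k a : nat) : multidigraph a.+1 :=
  Multidigraph (@mcar_src k a) (@mcar_tgt k a).

(** The vector (1, 0, ..., 0, -1). *)
Definition unit_netflow (R : realType) (n : nat) (j : 'I_n.+2) : R :=
  if j == ord0 then 1 else if j == ord_max then -1 else 0.

(** Lebesgue measure on R^d, as the d-fold product of [lebesgue_measure]; [\x]
    is the product measure, and R^(d+1) is identified with R * R^d. *)
Fixpoint lebesgue_tuple (R : realType) (d : nat) : set (d.-tuple R) -> \bar R :=
  match d with
  | 0 => \d_[tuple]
  | d'.+1 => fun A =>
      (lebesgue_measure \x @lebesgue_tuple R d')%E
        [set p : R * d'.-tuple R | A [tuple of p.1 :: p.2]]
  end.

Section relative_volume.
Variables (R : realType) (E : finType).
Implicit Types (P : set (E -> R)).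

Definition affine_hull P : set (E -> R) :=
  [set x | exists (n : nat) (w : 'I_n -> R) (y : 'I_n -> E -> R),
    [/\ forall i, P (y i), \sum_i w i = 1 &
        forall e, x e = \sum_i w i * y i e]].

(** The linear space parallel to the affine hull of P. *)
Definition direction P : set (E -> R) :=
  [set u | exists x y, [/\ affine_hull P x, affine_hull P y &
                           forall e, u e = x e - y e]].

(** B is a Z-basis of the lattice (direction P) ∩ Z^E, and this lattice has full
    rank in [direction P]; hence d is the dimension of P. *)
Definition lattice_basis P (d : nat) (B : 'I_d -> E -> int) : Prop :=
  [/\ forall i, direction P (fun e => (B i e)%:~R),
      forall z : E -> int, direction P (fun e => (z e)%:~R) ->
        exists c : 'I_d -> int, forall e, z e = \sum_i c i * B i e,
      forall c : 'I_d -> int,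
        (forall e, \sum_i c i * B i e = 0) -> forall i, c i = 0 &
      forall u, direction P u ->
        exists t : 'I_d -> R, forall e, u e = \sum_i t i * (B i e)%:~R].

(** The relative volume of P is the Lebesgue measure of P read in the affine
    coordinates given by a point of its affine hull and a lattice basis; it does
    not depend on these choices, since two coordinate systems differ by a
    translation and an element of GL_d(Z). *)
Definition has_normalized_volume P (v : \bar R) : Prop :=
  exists (d : nat) (p : E -> R) (B : 'I_d -> E -> int),
    [/\ affine_hull P p, lattice_basis P B &
        v = ((d`!)%:R%:E * lebesgue_tuple
              [set t : d.-tuple R |
                P (fun e => (p e + \sum_i tnth t i * (B i e)%:~R)%R)])%E].

End relative_volume.

Definition Cat (R : realType) (a b : nat) : R :=
  (a + b)%:R^-1 * 'C(a + b, a)%:R.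

(* Main.v *)
Require Import Defs.
From mathcomp Require Import all_boot all_order all_algebra.
From mathcomp Require Import all_classical all_reals all_analysis.
From mathcomp Require Import ring lra zify.

(** Let S_l be the flow on the last l edges out of vertex 0 and Z_j the flow on
    the last j edges into the sink.  A unit flow is determined by these partial
    sums, and nonnegativity of the flow becomes
      0 = S_0 <= S_1 <= ... <= S_(ka) = 1,  0 = Z_0 <= Z_1 <= ... <= Z_a = 1,
      S_(kj) <= Z_j  for 0 < j < a,
    so the polytope is unimodularly equivalent to the order polytope of two
    linked chains.  Integrate in the order S_1, ..., S_(k-1), Z_1, S_k, ...,
    S_(2k-1), Z_2, S_(2k), ... (innermost first).  With i variables S and j
    variables Z integrated out, the result as a function of the next variables
    s <= z of the two chains is
      s^i z^j / (i! j!) - k s^(i+1) z^(j-1) / ((i+1)! (j-1)!):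
    an S-step integrates over [0, s]; a Z-step integrates over [s, z] and happens
    when i + 1 = k (j + 1), which is exactly when the new polynomial vanishes on
    the diagonal s = z.  At i = ka - 1, j = a - 1, s = z = 1 this is
    Cat(a, ka - 1) / (ka + a - 2)!. *)

Set Implicit Arguments.
Unset Strict Implicit.
Unset Printing Implicit Defensive.

Import Order.TTheory GRing.Theory Num.Theory.
Import numFieldNormedType.Exports.

Local Open Scope classical_set_scope.
Local Open Scope ring_scope.

(** * Lebesgue measure on tuples as an iterated integral *)

Section IteratedIntegral.
Variable R : realType.
Local Notation mu := (@lebesgue_measure R).

Lemma lebesgue_tupleS (n : nat) (A : set (n.+1.-tuple R)) :
  lebesgue_tuple A =
  (\int[mu]_x lebesgue_tuple [set t : n.-tuple R | A [tuple of x :: t]])%E.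
Proof.
rewrite /= /product_measure1; apply: eq_integral => x _ /=.
congr (lebesgue_tuple _); apply/seteqP; split=> t /=.
  by rewrite /xsection /= inE.
by move=> h; rewrite /xsection /= inE.
Qed.

Lemma lebesgue_tuple_set0 (n : nat) :
  lebesgue_tuple (set0 : set (n.-tuple R)) = 0%E.
Proof.
elim: n => [|n IHn]; first by rewrite /= measure0.
by rewrite lebesgue_tupleS integral0_eq // => x _; rewrite -[RHS]IHn.
Qed.

Lemma lebesgue_tuple0T (A : set (0.-tuple R)) :
  A [tuple] -> lebesgue_tuple A = 1%E.
Proof. by move=> hA; rewrite /= diracE mem_set. Qed.

(** Outside [[a, b]] the slice is empty and has measure 0, so only the interval contributes. *)
Lemma lebesgue_tuple_slices (n : nat) (A : R -> set (n.-tuple R)) (a b : R) :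
  lebesgue_tuple [set t : n.+1.-tuple R |
    a <= thead t <= b /\ A (thead t) [tuple of behead t]] =
  (\int[mu]_(x in `[a, b]) lebesgue_tuple (A x))%E.
Proof.
rewrite lebesgue_tupleS [RHS]integral_mkcond; apply: eq_integral => x _.
rewrite patchE; case: ifPn => hx.
  congr (lebesgue_tuple _); apply/seteqP; split=> t /=.
    by rewrite theadE => -[_]; congr (A _ _); apply: val_inj.
  move=> At; move: hx; rewrite inE /= in_itv /= theadE => ->; split=> //.
  by congr (A _ _): At; apply: val_inj.
rewrite -[RHS](lebesgue_tuple_set0 n); congr (lebesgue_tuple _).
apply/seteqP; split=> t //=; rewrite theadE => -[hx' _].
by move: hx; rewrite notin_setE /= in_itv /= hx'.
Qed.

Lemma lebesgue_integral_deriv_poly (p : {poly R}) (a b : R) : a <= b ->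
  (\int[mu]_(x in `[a, b]) (p^`().[x])%:E)%E = (p.[b] - p.[a])%:E.
Proof.
rewrite le_eqVlt => /predU1P[->|ab].
  by rewrite set_itv1 integral_set1 subrr.
have cp (q : {poly R}) : continuous (horner q).
  by apply: continuous_horner.
rewrite (@continuous_FTC2 _ _ (horner p)) //.
- by apply: continuous_subspaceT => x; exact: cp.
- split=> [x _||]; first exact: derivable_horner.
    by apply: cvg_at_right_filter; exact: cp.
  by apply: cvg_at_left_filter; exact: cp.
- by move=> x _; rewrite derivE.
Qed.

End IteratedIntegral.

(** * Volume of two linked chains *)

Section ChainVolume.
Variables (R : realType) (k : nat).
Hypothesis k_gt0 : (0 < k)%N.
Local Notation mu := (@lebesgue_measure R).

(** The entries of [t] are read from the largest position down to position 1;
    the current one sits at position [(size t').+1], and it is a [Z]-coordinate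
    exactly when [k.+1] divides its successor (cf. [posS] and [posZ]).  The
    parameters [s] and [z] are the last [S]- and [Z]-coordinates read.  In this
    order [s <= z] always holds, so that no integration bound is a minimum. *)
Fixpoint chain_ok (t : seq R) (s z : R) : Prop :=
  if t is x :: t' then
    if (k.+1 %| (size t').+2)%N then s <= x <= z /\ chain_ok t' s x
    else 0 <= x <= s /\ chain_ok t' x z
  else True.

(** Divided powers: differentiation only lowers the index. *)
Definition divpow (n : nat) : {poly R} := (n`!%:R^-1) *: 'X^n.

Lemma deriv_divpow (n : nat) : (divpow n.+1)^`() = divpow n.
Proof.
rewrite /divpow derivZ derivXn -scalerMnr scalerMnl; congr (_ *: _).
by rewrite factS natrM invfM -mulr_natr mulrAC mulVf ?mul1r ?pnatr_eq0.
Qed.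

Lemma horner_divpow (n : nat) (x : R) : (divpow n).[x] = x ^+ n / n`!%:R.
Proof. by rewrite /divpow hornerZ hornerXn mulrC. Qed.

(** [s^i z^j / (i! j!) - k s^(i+1) z^(j-1) / ((i+1)! (j-1)!)], the continuous
    analogue of the ballot number ['C(i + j, j) - k * 'C(i + j, j - 1)]. *)
Definition ballot_poly (i j : nat) (s z : R) : R :=
  (divpow i).[s] * (divpow j).[z] -
  k%:R * (divpow i.+1).[s] * (if j is j'.+1 then (divpow j').[z] else 0).

(** The antiderivative in [s] has only positive powers, so it vanishes at the lower limit 0. *)
Lemma integral_ballot_poly_lower (i j : nat) (s z : R) : 0 <= s ->
  (\int[mu]_(x in `[0%R, s]) (ballot_poly i j x z)%:E)%E =
  (ballot_poly i.+1 j s z)%:E.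
Proof.
move=> s0; set c := if j is j'.+1 then (divpow j').[z] else 0.
pose p := (divpow j).[z] *: divpow i.+1 - (k%:R * c) *: divpow i.+2.
have -> : ballot_poly i.+1 j s z = p.[s] - p.[0].
  rewrite /ballot_poly /p -/c /divpow.
  rewrite !(hornerD, hornerN, hornerZ, hornerXn) !expr0n /=.
  by rewrite !mulr0; ring.
rewrite -lebesgue_integral_deriv_poly //; apply: eq_integral => x _; congr _%:E.
rewrite /p derivB derivZ [X in _ - X]derivZ !deriv_divpow.
rewrite /ballot_poly -/c /divpow !(hornerD, hornerN, hornerZ, hornerXn).
by ring.
Qed.

(** At the lower limit [s], the two terms of the antiderivative are multiples of s^(i+j+1) with
    coefficients 1/(i! (j+1)!) and k/((i+1)! j!), which cancel because i + 1 = k (j + 1). *)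
Lemma integral_ballot_poly_upper (i j : nat) (s z : R) : i.+1 = (k * j.+1)%N ->
  s <= z ->
  (\int[mu]_(x in `[s, z]) (ballot_poly i j s x)%:E)%E =
  (ballot_poly i j.+1 s z)%:E.
Proof.
move=> hij sz.
pose p := (divpow i).[s] *: divpow j.+1 - (k%:R * (divpow i.+1).[s]) *: divpow j.
have ps : p.[s] = 0.
  have nz m : m`!%:R != 0 :> R by rewrite pnatr_eq0 -lt0n fact_gt0.
  have hk : i.+1%:R = k%:R * j.+1%:R :> R by rewrite hij natrM.
  rewrite /p /divpow !(hornerD, hornerN, hornerZ, hornerXn).
  rewrite !factS !natrM !exprS hk.
  have k0 : k%:R != 0 :> R by rewrite pnatr_eq0 -lt0n.
  have j0 : j.+1%:R != 0 :> R by rewrite pnatr_eq0.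
  by field; rewrite !nz nat1r k0 j0.
have -> : ballot_poly i j.+1 s z = p.[z] - p.[s].
  by rewrite ps subr0 /ballot_poly /p !(hornerD, hornerN, hornerZ, hornerXn).
rewrite -lebesgue_integral_deriv_poly //; apply: eq_integral => x _; congr _%:E.
rewrite /p derivB derivZ [X in _ - X]derivZ deriv_divpow.
rewrite /ballot_poly !(hornerD, hornerN, hornerZ, hornerXn).
(* For [j = 0] the second term of [p] is constant; its derivative 0 is the default branch of
   [ballot_poly]. *)
case: j {hij p ps} => [|j]; last by rewrite deriv_divpow.
by rewrite /divpow expr0 alg_polyC derivC horner0.
Qed.

(** Induction, one integral per coordinate. Exactly [n.+1 %/ k.+1] of the positions 1, ..., n are
    Z-positions, namely the r with k + 1 dividing r + 1. *)
Lemma lebesgue_chain_ok (n : nat) (s z : R) : 0 <= s -> s <= z ->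
  lebesgue_tuple [set t : n.-tuple R | chain_ok t s z] =
  (ballot_poly (n - n.+1 %/ k.+1) (n.+1 %/ k.+1) s z)%:E.
Proof.
elim: n s z => [|n IHn] s z s0 sz.
  rewrite lebesgue_tuple0T // divn_small // /ballot_poly !horner_divpow.
  by rewrite !expr0 fact0 mulr0 subr0 divr1 mulr1.
have hj : (n.+1 %/ k.+1 <= n)%N.
  by rewrite -ltnS ltn_divLR // -{1}[n.+1]muln1 ltn_mul2l.
rewrite divnS //; set j := (n.+1 %/ k.+1)%N in hj IHn *.
have okE (t : n.+1.-tuple R) : chain_ok t s z =
  if (k.+1 %| n.+2)%N
  then s <= thead t <= z /\ chain_ok [tuple of behead t] s (thead t)
  else 0 <= thead t <= s /\ chain_ok [tuple of behead t] (thead t) z.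
  by case/tupleP: t => x t; rewrite /= theadE size_tuple.
under eq_set do rewrite okE.
case: (boolP (k.+1 %| n.+2)%N) => hd.
  rewrite (lebesgue_tuple_slices (fun x => [set t : n.-tuple R | chain_ok t s x])).
  rewrite add1n subSS.
  (* At a Z-position n + 2 = (k + 1) (j + 1), so the diagonal condition holds. *)
  have hn : (n - j).+1 = (k * j.+1)%N.
    have := divnK hd; rewrite divnS // hd add1n -/j => hE.
    by lia.
  rewrite -integral_ballot_poly_upper //; apply: eq_integral => x.
  rewrite inE /= in_itv /= => /andP[sx xz]; exact: IHn.
rewrite (lebesgue_tuple_slices (fun x => [set t : n.-tuple R | chain_ok t x z])).
rewrite add0n subSn // -integral_ballot_poly_lower //; apply: eq_integral => x.
rewrite inE /= in_itv /= => /andP[x0 xs]; apply: IHn => //.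
exact: le_trans xs sz.
Qed.

(** With m + 1 = k (a + 1), factoring out 1/(m! a!) leaves 1 - k a/(m + 1) = 1/(a + 1). *)
Lemma ballot_poly_Cat (a : nat) :
  ((k * a.+1 + a - 1)`!)%:R * ballot_poly (k * a.+1 - 1) a 1 1 =
  Cat R a.+1 (k * a.+1 - 1).
Proof.
have nz m : m`!%:R != 0 :> R by rewrite pnatr_eq0 -lt0n fact_gt0.
have [m hm] : exists m, (k * a.+1 = m.+1)%N.
  by exists (k * a.+1).-1; rewrite prednK // muln_gt0 k_gt0.
have hm' : m.+1%:R = k%:R * a.+1%:R :> R by rewrite -hm natrM.
rewrite /Cat /ballot_poly hm !subn1 !addSn /= !horner_divpow.
rewrite !expr1n.
have -> : ('C((a + m).+1, a.+1))%:R = (a + m).+1`!%:R / (a.+1`!%:R * m`!%:R) :> R.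
  have := @bin_fact (a + m).+1 a.+1; rewrite ltnS leq_addr subSS addKn.
  move=> /(_ isT) <-; by rewrite natrM [(_ * m`!)%:R]natrM mulfK // mulf_neq0 ?nz.
rewrite [(a + m)%N]addnC.
have k0 : k%:R != 0 :> R by rewrite pnatr_eq0 -lt0n.
have j0 b : b.+1%:R != 0 :> R by rewrite pnatr_eq0.
case: a {hm} hm' => [|a] hm'.
  rewrite mulr0 subr0 !addn0 !factS fact0 !natrM.
  by field; rewrite nz nat1r j0.
rewrite !horner_divpow !expr1n !factS !natrM hm'.
by field; rewrite !nz k0 !nat1r -!natrD nat1r !pnatr_eq0.
Qed.
End ChainVolume.

(** * Interleaving the positions of the two chains *)

Section Positions.
Variable k : nat.
Hypothesis k_gt0 : (0 < k)%N.

(** The order of integration: [S_l] is at position [posS l] and [Z_j] at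
    position [posZ j], so that [Z_j] comes just before [S_(k j)].  Position 0
    stands for both [S_0] and [Z_0]. *)
Definition posS (l : nat) : nat := (l + l %/ k)%N.
Definition posZ (j : nat) : nat := (k.+1 * j).-1.

Lemma posS0 : posS 0 = 0%N.
Proof. by rewrite /posS div0n. Qed.

Lemma posZ0 : posZ 0 = 0%N.
Proof. by rewrite /posZ muln0. Qed.

Lemma posS_leq : {mono posS : l l' / (l <= l')%N}.
Proof.
apply: leq_mono => l l' h; rewrite /posS -addSn leq_add //.
exact/leq_div2r/ltnW.
Qed.

Lemma posS_ltn : {mono posS : l l' / (l < l')%N}.
Proof. exact: leqW_mono posS_leq. Qed.

Lemma posZ_leq (j j' : nat) : (0 < j)%N -> (posZ j <= posZ j')%N = (j <= j')%N.
Proof.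
case: j => // j _; case: j' => [|j'].
  by rewrite posZ0 leqn0 ltn0 /posZ mulnS addSn /= addn_eq0 (gtn_eqF k_gt0).
by rewrite /posZ !mulnS !addSn /= !leq_add2l leq_pmul2l.
Qed.

(** Positions form blocks of length k + 1: residues below k carry S-coordinates, residue k a
    Z-coordinate. *)
Lemma posSM (q r : nat) : (r < k)%N -> posS (k * q + r) = (k.+1 * q + r)%N.
Proof.
by move=> rk; rewrite /posS mulnC divnMDl // (divn_small rk); lia.
Qed.

Lemma posSMl (q : nat) : posS (k * q) = (k.+1 * q)%N.
Proof. by have := posSM q k_gt0; rewrite !addn0. Qed.

Lemma posZK (j : nat) : (0 < j)%N -> (posZ j).+1 = (k.+1 * j)%N.
Proof. by move=> j0; rewrite /posZ prednK // muln_gt0. Qed.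

Lemma posSK (l : nat) : (posS l - posS l %/ k.+1 = l)%N.
Proof.
have rk := ltn_pmod l k_gt0; move: rk (divn_eq l k).
move: (l %% k)%N (l %/ k)%N => r q rk ->.
rewrite mulnC posSM // [(k.+1 * q)%N]mulnC divnMDl // divn_small ?leqW // addn0.
by rewrite mulnS -addnA addKn mulnC.
Qed.

Lemma dvdn_posZ (j : nat) : (0 < j)%N -> (k.+1 %| (posZ j).+1)%N.
Proof. by move=> j0; rewrite posZK // dvdn_mulr. Qed.

Lemma dvdn_posS (l : nat) : (k.+1 %| (posS l).+1)%N = false.
Proof.
rewrite (divn_eq l k) mulnC; have rk := ltn_pmod l k_gt0.
by rewrite posSM // -addnS dvdn_addr ?dvdn_mulr // gtnNdvd.
Qed.

Lemma posS_neq_posZ (l j : nat) : (0 < j)%N -> posS l != posZ j.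
Proof.
by move=> j0; apply: contraFneq (dvdn_posS l) => ->; exact: dvdn_posZ.
Qed.

Lemma posP (r : nat) : (0 < r)%N ->
  (exists2 l, (0 < l)%N & r = posS l) \/ (exists2 j, (0 < j)%N & r = posZ j).
Proof.
move=> r0; have [hd|hd] := boolP (k.+1 %| r.+1)%N.
  right; exists (r.+1 %/ k.+1)%N; first by rewrite divn_gt0 // dvdn_leq.
  by rewrite /posZ mulnC divnK.
(* Here b is nonzero, so r = (k + 1) q + (b - 1) with b - 1 < k is an S-position. *)
left; pose q := (r.+1 %/ k.+1)%N; pose b := (r.+1 %% k.+1)%N.
have hr : r.+1 = (k.+1 * q + b)%N by rewrite mulnC -divn_eq.
have b0 : (0 < b)%N by rewrite lt0n.
have bk : (b < k.+1)%N by rewrite ltn_pmod.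
have hS : posS (k * q + b.-1) = r by rewrite posSM; lia.
exists (k * q + b.-1)%N => //; rewrite lt0n; apply: contraTneq r0 => h0.
by rewrite -hS h0 posS0.
Qed.

End Positions.

(** * From the recursive predicate to chain inequalities *)

Section ChainOk.
Variables (R : realType) (k : nat).
Hypothesis k_gt0 : (0 < k)%N.
Local Notation posS := (posS k).
Local Notation posZ := (posZ k).

(** [t] lists the values at positions [size t], ..., 1; the out-of-range default
    of [nth] provides the value 0 at position 0. *)
Definition seqval (t : seq R) (s : R) (r : nat) : R :=
  if (r <= size t)%N then nth 0 t (size t - r) else s.

Lemma seqval0 (t : seq R) (s : R) : seqval t s 0 = 0.
Proof. by rewrite /seqval subn0 nth_default. Qed.

Lemma seqval_cons_same (x : R) (t : seq R) (s s' : R) (r : nat) :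
  (r <= size t)%N -> seqval (x :: t) s r = seqval t s' r.
Proof. by move=> h; rewrite /seqval /= h leqW // subSn. Qed.

Lemma seqval_head (x : R) (t : seq R) (s : R) : seqval (x :: t) s (size t).+1 = x.
Proof. by rewrite /seqval /= leqnn subnn. Qed.

Lemma seqval_default (t : seq R) (s : R) (r : nat) :
  (size t < r)%N -> seqval t s r = s.
Proof. by rewrite /seqval ltnNge => /negbTE ->. Qed.

Lemma seqval_cons_le (x : R) (t : seq R) (s : R) (r : nat) :
  (r <= (size t).+1)%N -> seqval (x :: t) s r = seqval t x r.
Proof.
rewrite leq_eqVlt => /predU1P[->|h]; last exact: seqval_cons_same.
by rewrite seqval_head seqval_default.
Qed.

Lemma seqval_cons_neq (x : R) (t : seq R) (s : R) (r : nat) :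
  r != (size t).+1 -> seqval (x :: t) s r = seqval t s r.
Proof.
rewrite neq_ltn ltnS => /orP[h|h]; first exact: seqval_cons_same.
by rewrite !seqval_default //; apply: ltnW.
Qed.

(** Induction on [t]: up to its own position, prepending [x] amounts to replacing the default of its
    chain by [x], as the recursion does; the other chain is unaffected. *)
Lemma chain_okP (t : seq R) (s z : R) :
  chain_ok k t s z <->
  (forall l, (0 < l)%N -> (posS l <= size t)%N ->
     0 <= seqval t s (posS l) <= seqval t s (posS l.+1)) /\
  (forall j, (0 < j)%N -> (posZ j <= size t)%N ->
     seqval t s (posS (k * j)) <= seqval t z (posZ j) <=
     seqval t z (posZ j.+1)).
Proof.
elim: t s z => [|x t IHt] s z.
  split=> // _; split=> [l l0|j j0] /=; rewrite leqn0 => /eqP h.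
    by have := posS_ltn k 0 l; rewrite l0 posS0 h ltnn.
  by have := posZ_leq k_gt0 0 j0; rewrite posZ0 h; lia.
rewrite /=; have [[l0 l0_gt0 hl0]|[j0 j0_gt0 hj0]] := posP k_gt0 (ltn0Sn (size t)).
  rewrite hl0 dvdn_posS //.
  have Z_neq j : (0 < j)%N -> posZ j != (size t).+1.
    by move=> j0; rewrite hl0 eq_sym posS_neq_posZ.
  have SE l : (l <= l0)%N -> seqval (x :: t) s (posS l) = seqval t x (posS l).
    by move=> h; rewrite seqval_cons_le // hl0 posS_leq.
  have ZE j : (0 < j)%N -> seqval (x :: t) z (posZ j) = seqval t z (posZ j).
    by move=> h; rewrite seqval_cons_neq // Z_neq.
  have SE0 : seqval (x :: t) s (posS l0) = x by rewrite -hl0 seqval_head.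
  have SE1 : seqval (x :: t) s (posS l0.+1) = s.
    by rewrite seqval_default //= hl0 posS_ltn.
  (* [S_(k j)] sits right after [Z_j], hence not beyond the position of [x]. *)
  have SMl j : (0 < j)%N -> (posZ j <= size t)%N -> (k * j <= l0)%N.
    by move=> j_gt0 hj; rewrite -(posS_leq k) -hl0 posSMl // -posZK.
  have small l : (posS l <= size t)%N -> (l < l0)%N.
    by rewrite -(posS_ltn k) -hl0.
  split=> [[hx /IHt[hS hZ]]|[hS hZ]].
    split=> [l l_gt0|j j_gt0].
      rewrite posS_leq leq_eqVlt => /predU1P[->|hl]; first by rewrite SE0 SE1.
      rewrite !SE ?(ltnW hl) //; apply: hS => //.
      by rewrite -ltnS hl0 posS_ltn.
    rewrite -hl0 leq_eqVlt (negbTE (Z_neq _ j_gt0)) /= ltnS => hj.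
    by rewrite SE ?SMl // !ZE //; apply: hZ.
  split; first by have := hS l0 l0_gt0 (leqnn _); rewrite SE0 SE1.
  apply/IHt; split=> [l l_gt0 hl|j j_gt0 hj].
    rewrite -!SE ?small // ?(ltnW (small _ hl)) //.
    by apply: hS; rewrite // -hl0 leqW.
  by rewrite -SE ?SMl // -!ZE //; apply: hZ; rewrite // -hl0 leqW.
rewrite hj0 dvdn_posZ //.
have S_neq l : posS l != (size t).+1 by rewrite hj0 posS_neq_posZ.
have SE l : seqval (x :: t) s (posS l) = seqval t s (posS l).
  by rewrite seqval_cons_neq.
have ZE j : (0 < j)%N -> (j <= j0)%N ->
    seqval (x :: t) z (posZ j) = seqval t x (posZ j).
  by move=> j_gt0 h; rewrite seqval_cons_le // hj0 posZ_leq.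
have ZE0 : seqval (x :: t) z (posZ j0) = x by rewrite -hj0 seqval_head.
have ZE1 : seqval (x :: t) z (posZ j0.+1) = z.
  by rewrite seqval_default //= hj0 ltnNge posZ_leq // ltnn.
(* [S_(k j0)] lies just past [x], so it is the default [s], and the bound [s <= x] is the link
   between the chains. *)
have SE0 : seqval t s (posS (k * j0)) = s.
  by rewrite seqval_default // posSMl // -posZK // -hj0 leqW.
have small j : (0 < j)%N -> (posZ j <= size t)%N -> (j < j0)%N.
  by move=> j_gt0; rewrite ltnNge -(posZ_leq k_gt0 j j0_gt0) -hj0 -ltnNge ltnS.
split=> [[hx /IHt[hS hZ]]|[hS hZ]].
  split=> [l l_gt0|j j_gt0].
    rewrite -hj0 leq_eqVlt (negbTE (S_neq l)) /= ltnS => hl.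
    by rewrite !SE; apply: hS.
  rewrite posZ_leq // leq_eqVlt SE => /predU1P[->|hj]; first by rewrite ZE0 ZE1 SE0.
  rewrite !ZE ?(ltnW hj) //; apply: hZ => //.
  by rewrite -ltnS hj0 ltnNge posZ_leq // -ltnNge.
split; first by have := hZ j0 j0_gt0 (leqnn _); rewrite ZE0 ZE1 SE SE0.
apply/IHt; split=> [l l_gt0 hl|j j_gt0 hj].
  by rewrite -!SE; apply: hS; rewrite // -hj0 leqW.
rewrite -SE -!ZE ?small // ?(ltnW (small _ _ hj)) //.
by apply: hZ; rewrite // -hj0 leqW.
Qed.

End ChainOk.

(** * Flows and their partial sums at the two ends *)

Lemma sum_ltn_split (I : finType) (V : zmodType) (f : I -> nat) (F : I -> V)
    (m n : nat) : (m <= n)%N ->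
  \sum_(i | (f i < n)%N) F i =
  \sum_(i | (f i < m)%N) F i + \sum_(i | (m <= f i < n)%N) F i.
Proof.
move=> mn; rewrite (bigID (fun i => f i < m)%N) /=; congr (_ + _).
  apply: eq_bigl => i; apply/andP/idP => [[]//|h]; split=> //.
  exact: leq_trans mn.
by apply: eq_bigl => i; rewrite -leqNgt andbC.
Qed.

Section Flows.
Variables (k a : nat).
Local Notation edges := (mcar_edge k a.+1).

Section Potentials.
Variable V : zmodType.
Implicit Types (S Z : nat -> V) (u : edges -> V).

(** [S l] is the total flow on the last [l] edges out of vertex 0 and [Z j] the
    total flow on the last [j] edges into the sink, so vertices are counted
    backwards from [a + 1].  The edge [(a + 1, a + 2)] enters the sink and
    therefore plays a special role among the edges [(i, i + 1)]. *)
Definition flow_of S Z (e : edges) : V :=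
  match e with
  | inl (inl i) =>
      if (i == a :> nat) then Z 1%N - Z 0%N else Z (a - i)%N - S (k * (a - i))%N
  | inl (inr i) => Z (a - i).+1 - Z (a - i)%N
  | inr (i, m) => S (k * (a - i) + m).+1 - S (k * (a - i) + m)%N
  end.

Definition excess u (v : 'I_a.+3) : V :=
  \sum_(e : edges | mcar_src e == v) u e - \sum_(e : edges | mcar_tgt e == v) u e.

Definition Ssum u (l : nat) : V :=
  \sum_(p : 'I_a.+1 * 'I_k | (k * (a - p.1) + p.2 < l)%N) u (inr p).

Definition Zsum u (j : nat) : V :=
  (if (0 < j)%N then u (inl (inl ord_max)) else 0) +
  \sum_(i < a | (a - i < j)%N) u (inl (inr i)).

(** A sum with at most one term, so that it is 0 for q = 0 and q > a; conservation then has one form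
    at all inner vertices. *)
Definition Ysum u (q : nat) : V :=
  \sum_(i < a.+1 | (i < a)%N && (a - i == q)%N) u (inl (inl i)).

Lemma eq_flow_of S S' Z Z' :
  (forall l, (l <= k * a.+1)%N -> S l = S' l) ->
  (forall j, (j <= a.+1)%N -> Z j = Z' j) ->
  flow_of S Z = flow_of S' Z'.
Proof.
move=> hS hZ; apply/funext => -[[i|i]|[i m]] /=.
- have h : (a - i <= a.+1)%N by rewrite leqW // leq_subr.
  by rewrite !hZ ?hS // leq_mul2l h orbT.
- have ia : (i < a)%N := ltn_ord i.
  by rewrite !hZ //; lia.
- have h : (k * (a - i) + m < k * a.+1)%N.
    rewrite mulnS addnC -addSn leq_add // leq_mul2l leq_subr orbT //.
  by rewrite !hS // ltnW.
Qed.

Lemma Ssum0 u : Ssum u 0 = 0.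
Proof. by rewrite /Ssum big_pred0. Qed.

Lemma Zsum0 u : Zsum u 0 = 0.
Proof. by rewrite /Zsum add0r big_pred0. Qed.

Lemma Zsum1 u : Zsum u 1 = u (inl (inl ord_max)).
Proof.
rewrite /Zsum /= big_pred0 ?addr0 // => i.
by have := ltn_ord i; lia.
Qed.

Lemma ZsumS u (j : nat) : (0 < j)%N ->
  Zsum u j.+1 = Zsum u j + \sum_(i < a | (a - i == j)%N) u (inl (inr i)).
Proof.
move=> j0; rewrite /Zsum j0 -addrA; congr (_ + _).
rewrite (sum_ltn_split _ _ (leqnSn j)); congr (_ + _).
by apply: eq_bigl => i; lia.
Qed.

Lemma ZsumS_edge u (i : 'I_a) :
  Zsum u (a - i).+1 = Zsum u (a - i) + u (inl (inr i)).
Proof.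
have ia := ltn_ord i; rewrite ZsumS ?subn_gt0 //; congr (_ + _).
rewrite (eq_bigl (pred1 i)) ?big_pred1_eq // => i' /=.
by rewrite -val_eqE /=; have := ltn_ord i'; lia.
Qed.

(** The differences telescope. *)
Lemma Zsum_flow_of S Z (j : nat) : (j <= a.+1)%N ->
  Zsum (flow_of S Z) j = Z j - Z 0%N.
Proof.
elim: j => [|[|j] IHj] hj; first by rewrite Zsum0 subrr.
  by rewrite Zsum1 /= eqxx.
have hi : (a - j.+1 < a)%N by lia.
have hE : (a - Ordinal hi = j.+1)%N by rewrite /= subKn.
by rewrite -hE ZsumS_edge hE IHj ?(ltnW hj) //= subKn // addrC addrA subrK.
Qed.

Lemma Ysum_edge u (i : 'I_a.+1) : (i < a)%N -> Ysum u (a - i) = u (inl (inl i)).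
Proof.
move=> ia; rewrite /Ysum (eq_bigl (pred1 i)) ?big_pred1_eq // => i' /=.
by rewrite -val_eqE /=; have := ltn_ord i'; lia.
Qed.

Lemma Ysum0 u : Ysum u 0 = 0.
Proof. by rewrite /Ysum big_pred0 // => i; lia. Qed.

Lemma Ysum_large u (q : nat) : (a < q)%N -> Ysum u q = 0.
Proof. by move=> h; rewrite /Ysum big_pred0 // => i; lia. Qed.

Lemma excess0 u : excess u ord0 = Ssum u (k * a.+1).
Proof.
rewrite /excess !big_sumType /=.
rewrite big_pred0; last first.
  by move=> i; rewrite -val_eqE /= inordK //; have := ltn_ord i; lia.
rewrite big_pred0; last first.
  by move=> i; rewrite -val_eqE /= inordK //; have := ltn_ord i; lia.
rewrite [X in _ - (X + _ + _)]big_pred0; last first.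
  by move=> i; rewrite -val_eqE /= inordK //; have := ltn_ord i; lia.
rewrite [X in _ - (_ + X + _)]big_pred0 //.
rewrite [X in _ - (_ + X)]big_pred0; last first.
  by move=> [i m]; rewrite -val_eqE /= inordK //; have := ltn_ord i; lia.
rewrite !add0r !subr0 /Ssum; apply: eq_big => // -[i m] /=; rewrite eqxx; symmetry.
rewrite mulnS addnC -addSn leq_add //.
by rewrite leq_mul2l leq_subr orbT.
Qed.

Hypothesis k_gt0 : (0 < k)%N.

Lemma block_index (q q' m : nat) : (m < k)%N ->
  (k * q <= k * q' + m < k * q.+1)%N = (q' == q).
Proof.
move=> mk; apply/andP/eqP => [[h1 h2]|->]; last by rewrite mulnS; lia.
apply/eqP; rewrite eqn_leq; apply/andP; split.
  by rewrite -ltnS -(ltn_pmul2l k_gt0); apply: leq_ltn_trans h2; rewrite leq_addr.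
rewrite -ltnS -(ltn_pmul2l k_gt0); apply: leq_ltn_trans h1 _.
by rewrite mulnS; lia.
Qed.

Lemma Ssum_block u (q : nat) :
  Ssum u (k * q.+1) =
  Ssum u (k * q) + \sum_(p : 'I_a.+1 * 'I_k | (a - p.1 == q)%N) u (inr p).
Proof.
have hq : (k * q <= k * q.+1)%N by rewrite leq_mul2l leqnSn orbT.
rewrite /Ssum (sum_ltn_split _ _ hq); congr (_ + _).
by apply: eq_bigl => -[i m] /=; rewrite block_index.
Qed.

Lemma SsumS_edge u (i : 'I_a.+1) (m : 'I_k) :
  Ssum u (k * (a - i) + m).+1 = Ssum u (k * (a - i) + m)%N + u (inr (i, m)).
Proof.
rewrite /Ssum (sum_ltn_split _ _ (leqnSn _)); congr (_ + _).
rewrite (eq_bigl (pred1 (i, m))) ?big_pred1_eq // => -[i' m'] /=.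
rewrite xpair_eqE -!val_eqE /= ltnS -eqn_leq eq_sym.
apply/eqP/andP => [h|[/eqP -> /eqP -> //]].
have /eqP hi : (a - i' == a - i)%N.
  rewrite -(block_index _ _ (ltn_ord m')) h block_index //.
have h1 := ltn_ord i; have h2 := ltn_ord i'.
by move: h; rewrite hi => /addnI ->; split=> //; apply/eqP; lia.
Qed.

Lemma chain_index (l : nat) : (l < k * a.+1)%N ->
  exists (i : 'I_a.+1) (m : 'I_k), l = (k * (a - i) + m)%N.
Proof.
move=> hl; have hq : (l %/ k < a.+1)%N by rewrite ltn_divLR // mulnC.
exists (inord (a - l %/ k)), (Ordinal (ltn_pmod l k_gt0)) => /=.
rewrite inordK ?ltnS ?leq_subr // subKn // {1}(divn_eq l k) mulnC //.
Qed.

Lemma Ssum_flow_of S Z (l : nat) : (l <= k * a.+1)%N ->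
  Ssum (flow_of S Z) l = S l - S 0%N.
Proof.
elim: l => [|l IHl] hl; first by rewrite Ssum0 subrr.
have [i [m hE]] := chain_index hl.
by rewrite hE SsumS_edge -hE IHl ?(ltnW hl) //= -hE addrC addrA subrK.
Qed.

Lemma excessS u (i : 'I_a.+1) : let q := (a - i)%N in
  excess u (inord i.+1) =
  Ysum u q + (Zsum u q.+1 - Zsum u q) - Ysum u q.+1 -
  (Ssum u (k * q.+1) - Ssum u (k * q)).
Proof.
move=> q; have ia : (i <= a)%N by rewrite -ltnS.
have i1 : (i.+1 < a.+3)%N by rewrite ltnS leqW.
rewrite /excess !big_sumType /=.
have -> : \sum_(i' < a.+1 | (inord i'.+1 : 'I_a.+3) == inord i.+1)
    u (inl (inl i')) = u (inl (inl i)).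
  rewrite (eq_bigl (pred1 i)) ?big_pred1_eq // => i' /=.
  by rewrite -!val_eqE /= !inordK // ltnS leqW.
have -> : \sum_(i' < a | (inord i'.+1 : 'I_a.+3) == inord i.+1)
    u (inl (inr i')) = \sum_(i' < a | (a - i' == q)%N) u (inl (inr i')).
  apply: eq_bigl => i'; rewrite -!val_eqE /= !inordK //.
    by rewrite /q; have := ltn_ord i'; lia.
  by rewrite !ltnS ltnW // leqW.
rewrite [X in _ + X - _]big_pred0; last first.
  by move=> p; rewrite -val_eqE /= inordK.
have -> : \sum_(i' < a.+1 | (inord i'.+2 : 'I_a.+3) == inord i.+1)
    u (inl (inl i')) = Ysum u q.+1.
  apply: eq_bigl => i'; rewrite -!val_eqE /=.
  by have hi' := ltn_ord i'; rewrite !inordK // /q; lia.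
rewrite [X in _ - (_ + X + _)]big_pred0; last first.
  by move=> i'; rewrite -val_eqE /= inordK // gtn_eqF.
have -> : \sum_(p : 'I_a.+1 * 'I_k |
      (let (i0, _) := p in inord i0.+1 : 'I_a.+3) == inord i.+1) u (inr p) =
    Ssum u (k * q.+1) - Ssum u (k * q).
  rewrite Ssum_block addrC addKr; apply: eq_bigl => -[i' m] /=.
  by rewrite -!val_eqE /= !inordK ?ltnS ?leqW //; have := ltn_ord i'; rewrite /q; lia.
rewrite !addr0 opprD addrA; congr (_ - _ - _).
have [ia'|] := ltnP i a.
  rewrite -(Ysum_edge u ia') ZsumS ?subn_gt0 //; congr (_ + _).
  by rewrite addrC addKr.
(* At the last inner vertex the only outgoing edge is the one that [Zsum] counts first and [Ysum]
   excludes. *)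
move=> ai; have {ai}hi : i = ord_max by apply/val_inj/eqP; rewrite eqn_leq ia.
rewrite /q hi /= subnn Ysum0 add0r Zsum1 Zsum0 subr0 big_pred0 ?addr0 //.
by move=> i'; have := ltn_ord i'; lia.
Qed.

Lemma excess_flow_of S Z (i : 'I_a.+1) : S 0%N = 0 -> Z 0%N = 0 ->
  S (k * a.+1)%N = Z a.+1 -> excess (flow_of S Z) (inord i.+1) = 0.
Proof.
move=> S0 Z0 SZ; have ia : (i <= a)%N by rewrite -ltnS.
(* The boundary values extend the formula to q = 0 and q = a + 1, where no edge exists. *)
have YE q : (q <= a.+1)%N -> Ysum (flow_of S Z) q = Z q - S (k * q)%N.
  case: q => [|q] hq; first by rewrite Ysum0 muln0 S0 Z0 subrr.
  move: hq; rewrite leq_eqVlt => /predU1P[[->]|].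
    by rewrite Ysum_large // SZ subrr.
  rewrite ltnS => hq; have hi : (a - q.+1 < a.+1)%N by lia.
  have hi' : (Ordinal hi < a)%N by rewrite /=; lia.
  have {1}<- : (a - Ordinal hi = q.+1)%N by rewrite /= subKn.
  by rewrite Ysum_edge //= subKn // ltn_eqF.
have hk b : (b <= a.+1)%N -> (k * b <= k * a.+1)%N by rewrite leq_mul2l orbC => ->.
rewrite excessS !YE ?Zsum_flow_of ?Ssum_flow_of ?hk ?S0 ?Z0 ?subr0 //; try lia.
set x := Z _; set y := S _; set z := Z _; set w := S _.
rewrite [x - y + _]addrC addrA subrK [- (z - w)]opprB.
by rewrite [z - y + _]addrC addrA subrK subrr.
Qed.

(** Conservation over the last q inner vertices: what they send to the sink, minus what vertex 0
    sends them, enters by the single path edge. For q = a + 1 there is no such edge, whence the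
    second equality. *)
Lemma flow_of_sums u : (forall i : 'I_a.+1, excess u (inord i.+1) = 0) ->
  flow_of (Ssum u) (Zsum u) = u /\ Zsum u a.+1 = Ssum u (k * a.+1).
Proof.
move=> h.
have YE q : (q <= a.+1)%N -> Ysum u q = Zsum u q - Ssum u (k * q).
  elim: q => [|q IHq] hq; first by rewrite Ysum0 muln0 Zsum0 Ssum0 subrr.
  have hi : (a - q < a.+1)%N by lia.
  have := h (Ordinal hi); rewrite excessS /= subKn // IHq; last exact: ltnW.
  set x := Zsum u q; set y := Ssum u _; set z := Zsum _ _; set w := Ssum _ _.
  move: x y z w => x y z w.
  move=> /eqP; rewrite subr_eq0 subr_eq => /eqP hE.
  have : z - y = w - y + Ysum u q.+1 by rewrite -hE [RHS]addrC addrA subrK.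
  rewrite addrAC => hz; have -> : z = w + Ysum u q.+1 by apply: (addIr (- y)).
  by rewrite addrAC subrr add0r.
split; last first.
  have := YE _ (leqnn _); rewrite Ysum_large // => /eqP.
  by rewrite eq_sym subr_eq0 => /eqP.
apply/funext => -[[i|i]|[i m]] /=.
- case: eqP => [hi|/eqP hi].
    by rewrite Zsum1 Zsum0 subr0; congr (u (inl (inl _))); apply/val_inj.
  have hi' : (i < a)%N by rewrite ltn_neqAle hi -ltnS ltn_ord.
  by rewrite -YE ?Ysum_edge // leqW // leq_subr.
- by rewrite ZsumS_edge addrC addKr.
- by rewrite SsumS_edge addrC addKr.
Qed.

End Potentials.
End Flows.

(** * Coordinate vectors indexed by position *)

Section Combination.
Variables (d : nat) (V : nzRingType) (c : 'I_d -> V).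

(** Entry [i] of a coordinate vector is the value at position [d - i]. *)
Definition comb (r : nat) : V := \sum_(i < d) c i * (r + i == d)%N%:R.

Lemma comb_ord (i : 'I_d) : comb (d - i) = c i.
Proof.
rewrite /comb (bigD1 i) //= subnK ?eqxx ?mulr1; last exact: ltnW.
rewrite big1 ?addr0 // => i' ne.
suff -> : (d - i + i' == d)%N = false by rewrite mulr0.
apply: contraNF ne; rewrite -val_eqE /= => /eqP h; apply/eqP.
by have := ltn_ord i; lia.
Qed.

Lemma comb_out (r : nat) : (r == 0)%N || (d < r)%N -> comb r = 0.
Proof.
move=> h; rewrite /comb big1 // => i _.
suff -> : (r + i == d)%N = false by rewrite mulr0.
by have := ltn_ord i; lia.
Qed.

Lemma comb_in (r : nat) (T : nat -> V) : (0 < r <= d)%N ->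
  (forall i, c i = T (d - i)%N) -> comb r = T r.
Proof.
move=> hr hc; have hi : (d - r < d)%N by lia.
have hE : (d - Ordinal hi = r)%N by rewrite /= subKn //; lia.
by rewrite -{1}hE comb_ord hc hE.
Qed.

End Combination.

(** * The flow polytope in chain coordinates *)

Section ChainFlows.
Variables (R : realType) (k a : nat).
Hypothesis k_gt0 : (0 < k)%N.
Local Notation posS := (posS k).
Local Notation posZ := (posZ k).
Local Notation P := (flow_polytope (G := MCar k a.+1) (unit_netflow R (n := a.+1))).
Local Notation d := (k * a.+1 + a - 1)%N.

(** Positions 1, ..., d are the free coordinates; d + 1 and d + 2 belong to [Z_(a+1)] and
    [S_(k(a+1))], whose values are fixed. *)
Lemma posS_gtd (l : nat) : (d < posS l)%N = (k * a.+1 <= l)%N.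
Proof.
have ka : (0 < k * a.+1)%N by rewrite muln_gt0 k_gt0.
have [h|h] := leqP (k * a.+1) l.
  by rewrite -(posS_leq k) posSMl // in h; apply: leq_trans h; rewrite mulSn; lia.
have h' : (l %/ k <= a)%N by rewrite -ltnS ltn_divLR // mulnC.
by apply/negbTE; rewrite -leqNgt /(posS _); lia.
Qed.

Lemma posZ_gtd (j : nat) : (d < posZ j)%N = (a.+1 <= j)%N.
Proof.
have ka : (0 < k * a.+1)%N by rewrite muln_gt0 k_gt0.
have hE : d.+1 = posZ a.+1 by move: (posZK k (ltn0Sn a)); rewrite mulSn; lia.
by rewrite hE posZ_leq.
Qed.

(** [flow_of] conserves flow at inner vertices, and the end values give vertex 0 unit outflow. *)
Lemma flow_polytope_flow_of (S Z : nat -> R) :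
  S 0%N = 0 -> Z 0%N = 0 -> S (k * a.+1)%N = 1 -> Z a.+1 = 1 ->
  P (@flow_of k a _ S Z) <-> forall e, 0 <= @flow_of k a _ S Z e.
Proof.
move=> S0 Z0 S1 Z1; split=> [[]//|h]; split=> // j hj.
rewrite -[LHS]/(excess (@flow_of k a _ S Z) j) /unit_netflow.
case: eqVneq => [->|j0]; first by rewrite excess0 // Ssum_flow_of // S1 S0 subr0.
rewrite ifN; last by rewrite -val_eqE /= ltn_eqF.
have hi : (j.-1 < a.+1)%N by case: (j : nat) hj => //.
have -> : j = inord (Ordinal hi).+1.
  by rewrite -[LHS]inord_val /= prednK // lt0n; apply: contra j0; rewrite -val_eqE.
by rewrite excess_flow_of // S1 Z1.
Qed.

(** Edges out of vertex 0 give the S-chain, edges into the sink the Z-chain, and the other path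
    edges the links. *)
Lemma flow_of_ge0 (S Z : nat -> R) : S 0%N = 0 -> Z 0%N = 0 ->
  (forall e, 0 <= @flow_of k a _ S Z e) <->
  [/\ forall l, (l < k * a.+1)%N -> S l <= S l.+1,
      forall j, (j < a.+1)%N -> Z j <= Z j.+1 &
      forall j, (0 < j <= a)%N -> S (k * j)%N <= Z j].
Proof.
move=> S0 Z0; split=> [h|[hS hZ hSZ]].
  split=> [l hl|j hj|j /andP[j0 ja]].
  - have [i [m ->]] := chain_index k_gt0 hl.
    by have := h (inr (i, m)); rewrite /= subr_ge0.
  - case: j hj => [|j] hj.
      by have := h (inl (inl ord_max)); rewrite /= eqxx subr_ge0.
    have hi : (a - j.+1 < a)%N by lia.
    by have := h (inl (inr (Ordinal hi))); rewrite /= subr_ge0 subKn.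
  - have hi : (a - j < a.+1)%N by lia.
    have := h (inl (inl (Ordinal hi))); rewrite /= ifN; last by lia.
    by rewrite subr_ge0 subKn.
move=> [[i|i]|[i m]] /=; have hi := ltn_ord i.
- case: ifPn => hia; rewrite subr_ge0; first exact: hZ.
  by apply: hSZ; lia.
- by rewrite subr_ge0 hZ // ltnS leq_subr.
- rewrite subr_ge0 hS // mulnS addnC -addSn leq_add //.
  by rewrite leq_mul2l leq_subr orbT.
Qed.

(** These are the flows given by the indicators of the up-sets of the poset. *)
Lemma vertex_in_flow_polytope (p q : nat) :
  (0 < p <= k * a.+1)%N -> (0 < q <= a.+1)%N ->
  (forall j, (j <= a)%N -> (p <= k * j)%N -> (q <= j)%N) ->
  P (@flow_of k a _ (fun l => (p <= l)%N%:R) (fun j => (q <= j)%N%:R)).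
Proof.
move=> /andP[p0 p1] /andP[q0 q1] hpq.
have S0 : (p <= 0)%N%:R = 0 :> R by rewrite leqNgt p0.
have Z0 : (q <= 0)%N%:R = 0 :> R by rewrite leqNgt q0.
apply/flow_polytope_flow_of; rewrite ?p1 ?q1 //.
apply/flow_of_ge0 => //; split=> [l hl|j hj|j /andP[j0 ja]]; rewrite ler_nat.
- by have [h|//] := leqP p l; rewrite leqW.
- by have [h|//] := leqP q j; rewrite leqW.
- by have [h|//] := leqP p (k * j); rewrite hpq.
Qed.

(** The image under the linear map [flow_of] of the unit vector at position [d - i]. *)
Definition basis_flow (i : 'I_d) (e : mcar_edge k a.+1) : int :=
  @flow_of k a _ (fun l => (posS l + i == d)%N%:R) (fun j => (posZ j + i == d)%N%:R) e.

Lemma comb_basis (V : nzRingType) (c : 'I_d -> V) (e : mcar_edge k a.+1) :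
  \sum_i c i * (basis_flow i e)%:~R =
  @flow_of k a _ (fun l => comb c (posS l)) (fun j => comb c (posZ j)) e.
Proof.
rewrite /basis_flow; case: e => [[i|i]|[i m]] /=; try case: ifP => _;
  rewrite /comb -sumrB; apply: eq_bigr => x _;
  by rewrite intrB !mulrz_nat mulrBr.
Qed.

End ChainFlows.

(** * The lattice basis and the polytope in its coordinates *)

Lemma subset_affine_hull (R : realType) (E : finType) (Q : set (E -> R)) :
  Q `<=` affine_hull Q.
Proof.
move=> x Qx; exists 1%N, (fun=> 1), (fun=> x); split=> // [|e].
  by rewrite big_ord1.
by rewrite big_ord1 mul1r.
Qed.

Section LatticeBasis.
Variables (R : realType) (k a : nat).
Hypothesis k_gt0 : (0 < k)%N.
Local Notation posS := (posS k).
Local Notation posZ := (posZ k).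
Local Notation P := (flow_polytope (G := MCar k a.+1) (unit_netflow R (n := a.+1))).
Local Notation d := (k * a.+1 + a - 1)%N.
Local Notation excess := (@excess k a _).

Lemma affine_hull_excess (x : mcar_edge k a.+1 -> R) (v : 'I_a.+3) :
  affine_hull P x -> (v < a.+2)%N -> excess x v = unit_netflow R v.
Proof.
move=> [n [w [y [Py w1 hx]]]] hv.
have sumE (Q : pred (mcar_edge k a.+1)) :
    \sum_(e | Q e) x e = \sum_i w i * \sum_(e | Q e) y i e.
  under eq_bigr do rewrite hx.
  by rewrite exchange_big; apply: eq_bigr => i _; rewrite mulr_sumr.
rewrite /excess !sumE -sumrB -[RHS]mul1r -w1 mulr_suml; apply: eq_bigr => i _.
by rewrite -mulrBr; congr (_ * _); exact: (Py i).2.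
Qed.

Lemma direction_excess (u : mcar_edge k a.+1 -> R) (v : 'I_a.+3) :
  direction P u -> (v < a.+2)%N -> excess u v = 0.
Proof.
move=> [x [y [hx hy hu]]] hv; rewrite /excess.
under eq_bigr do rewrite hu; under [X in _ - X]eq_bigr do rewrite hu.
rewrite !sumrB; have := affine_hull_excess hx hv; have := affine_hull_excess hy hv.
by rewrite /excess; lra.
Qed.

(** The coordinates are the partial sums of [u]. With [V] the integers this gives lattice
    generation, with [V] the reals spanning. *)
Lemma coordinates (V : nzRingType) (u : mcar_edge k a.+1 -> V) :
  (forall v : 'I_a.+3, (v < a.+2)%N -> excess u v = 0) ->
  exists c : 'I_d -> V, forall e, u e = \sum_i c i * (basis_flow i e)%:~R.
Proof.
move=> hu.
have [i|hE hZS] := @flow_of_sums k a _ k_gt0 u.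
  by apply: hu; rewrite inordK ltnS // leqW.
have hS1 : Ssum u (k * a.+1) = 0 by rewrite -excess0 // hu.
(* [T] inverts [posZ] and [posS] to read off the partial sum at position r. *)
pose T r := if (k.+1 %| r.+1)%N then Zsum u (r.+1 %/ k.+1)
            else Ssum u (r - r %/ k.+1).
exists (fun i => T (d - i)%N) => e; rewrite comb_basis -[in LHS]hE.
congr (_ e); apply: eq_flow_of => [l hl|j hj].
  case: (posnP l) => [->|l0]; first by rewrite posS0 comb_out ?Ssum0.
  have [h|h] := leqP (posS l) d.
    rewrite (comb_in (T := T)) // ?h ?andbT; last by rewrite -(posS0 k) posS_ltn.
    by rewrite /T dvdn_posS // posSK.
  rewrite comb_out ?h ?orbT //; move: h; rewrite posS_gtd // => h.
  by have /eqP -> : l == (k * a.+1)%N; rewrite // eqn_leq hl.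
case: (posnP j) => [->|j0]; first by rewrite posZ0 comb_out ?Zsum0.
have [h|h] := leqP (posZ j) d.
  rewrite (comb_in (T := T)) // ?h ?andbT.
    by rewrite /T dvdn_posZ // posZK // mulKn.
  by rewrite ltnNge -(posZ0 k) posZ_leq // -ltnNge.
rewrite comb_out ?h ?orbT //; move: h; rewrite posZ_gtd // => h.
by have /eqP -> : j == a.+1; rewrite ?hZS // eqn_leq hj.
Qed.

(** The partial sums of a flow recover [S] and [Z], and every position belongs to one of them. *)
Lemma basis_flow_free (V : nzRingType) (c : 'I_d -> V) :
  (forall e, \sum_i c i * (basis_flow i e)%:~R = 0) -> forall i, c i = 0.
Proof.
move=> hc.
set S := fun l => comb c (posS l); set Z := fun j => comb c (posZ j).
have h0 : @flow_of k a _ S Z = fun=> 0.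
  by apply/funext => e; rewrite -comb_basis hc.
have S0 : S 0%N = 0 by rewrite /S posS0 comb_out.
have Z0 : Z 0%N = 0 by rewrite /Z posZ0 comb_out.
have hS l : (l <= k * a.+1)%N -> S l = 0.
  move=> hl; rewrite -[LHS]subr0 -S0 -(Ssum_flow_of k_gt0 S Z hl) h0.
  by rewrite /Ssum big1.
have hZ j : (j <= a.+1)%N -> Z j = 0.
  move=> hj; rewrite -[LHS]subr0 -Z0 -(Zsum_flow_of k S Z hj) h0.
  by rewrite /Zsum big1 // if_same addr0.
move=> i; rewrite -comb_ord.
have [|[l l0 hl]|[j j0 hj]] := @posP k k_gt0 (d - i)%N; first by rewrite subn_gt0.
  rewrite hl; apply: hS; apply: ltnW; rewrite ltnNge -posS_gtd // -leqNgt -hl.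
  exact: leq_subr.
rewrite hj; apply: hZ; apply: ltnW; rewrite ltnNge -(posZ_gtd a k_gt0) -leqNgt -hj.
exact: leq_subr.
Qed.

(** Each basis flow is the difference of two indicator flows whose up-sets differ in one element. *)
Lemma basis_flow_direction (i : 'I_d) :
  direction P (fun e => (basis_flow i e)%:~R).
Proof.
have hP : exists p q p' q' : nat, [/\
    P (@flow_of k a _ (fun l => (p <= l)%N%:R) (fun j => (q <= j)%N%:R)),
    P (@flow_of k a _ (fun l => (p' <= l)%N%:R) (fun j => (q' <= j)%N%:R)),
    forall l, (posS l + i == d)%N%:R = (p <= l)%N%:R - (p' <= l)%N%:R :> int &
    forall j, (posZ j + i == d)%N%:R = (q <= j)%N%:R - (q' <= j)%N%:R :> int].
  have hi := ltn_ord i.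
  have h r : (r + i == d)%N = (r == d - i)%N by lia.
  have [|[l l0 hl]|[j j0 hj]] := @posP k k_gt0 (d - i)%N; first by rewrite subn_gt0.
    have lk : (l < k * a.+1)%N.
      by rewrite ltnNge -posS_gtd // -leqNgt -hl leq_subr.
    have q1 : (l.-1 %/ k < a.+1)%N by rewrite ltn_divLR // mulnC; lia.
    have hq j : (l <= k * j)%N -> (l.-1 %/ k < j)%N.
      by move=> hj; rewrite ltn_divLR // mulnC; lia.
    (* The common threshold on Z is the least j with l <= k j, which respects the links for both l
       and l + 1. *)
    exists l, (l.-1 %/ k).+1, l.+1, (l.-1 %/ k).+1; split.
    - by apply: vertex_in_flow_polytope => // [|j _]; [rewrite l0 ltnW | exact: hq].
    - by apply: vertex_in_flow_polytope => // j _ /ltnW; exact: hq.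
    - move=> l'; rewrite h hl (inj_eq (incn_inj (posS_leq k))).
      by case: (ltngtP l l').
    - move=> j; rewrite subrr h hl; case: (posnP j) => [->|j0].
        by rewrite posZ0 -hl ltn_eqF // subn_gt0.
      by rewrite eq_sym (negbTE (posS_neq_posZ k_gt0 _ j0)).
  have ja : (j <= a)%N by rewrite leqNgt -(posZ_gtd a k_gt0) -leqNgt -hj leq_subr.
  have ka : (0 < k * a.+1 <= k * a.+1)%N by rewrite leqnn muln_gt0 k_gt0.
  (* With S jumping only at its last index, no link constrains the threshold on Z. *)
  exists (k * a.+1)%N, j, (k * a.+1)%N, j.+1; split.
  - apply: vertex_in_flow_polytope => //; first by rewrite j0 leqW.
    by move=> j' ja'; rewrite leq_pmul2l //; lia.
  - by apply: vertex_in_flow_polytope => // j' ja'; rewrite leq_pmul2l //; lia.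
  - by move=> l; rewrite subrr h hj (negbTE (posS_neq_posZ k_gt0 _ j0)).
  - move=> j'; rewrite h hj.
    have -> : (posZ j' == posZ j) = (j' == j).
      case: (posnP j') => [->|j'0].
        by rewrite posZ0 -hj ltn_eqF ?subn_gt0 // ltn_eqF.
      by rewrite eqn_leq !posZ_leq // -eqn_leq.
    by case: (ltngtP j j').
have [p [q [p' [q' [h1 h2 hS hZ]]]]] := hP.
exists (@flow_of k a _ (fun l => (p <= l)%N%:R) (fun j => (q <= j)%N%:R)).
exists (@flow_of k a _ (fun l => (p' <= l)%N%:R) (fun j => (q' <= j)%N%:R)).
split=> [||e]; try exact: subset_affine_hull.
rewrite /basis_flow; case: e => [[e|e]|[e m]] /=; try case: ifP => _;
  by rewrite !(hS, hZ) !intrB !mulrz_nat; ring.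
Qed.

Lemma lattice_basis_flow : lattice_basis P (@basis_flow k a).
Proof.
split.
- exact: basis_flow_direction.
- move=> z hz; have [v hv|c hc] := @coordinates _ z.
    have := direction_excess hz hv.
    (* Conservation descends from the reals to the integers by injectivity of the cast. *)
    rewrite /excess -!(raddf_sum (intr : {additive int -> R})) -intrB /=.
    by move=> /eqP; rewrite intr_eq0 => /eqP.
  by exists c => e; rewrite hc; apply: eq_bigr => i _; rewrite intz.
- move=> c hc; apply: basis_flow_free => e; rewrite -[RHS](hc e).
  by apply: eq_bigr => i _; rewrite intz.
- by move=> u hu; apply: coordinates => v; exact: direction_excess.
Qed.

Lemma flow_coordinates (t : d.-tuple R) (e : mcar_edge k a.+1) :
  @flow_of k a R (fun l => (k * a.+1 <= l)%N%:R) (fun j => (a.+1 <= j)%N%:R) e +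
  \sum_i tnth t i * (basis_flow i e)%:~R =
  @flow_of k a R (fun l => seqval t 1 (posS l)) (fun j => seqval t 1 (posZ j)) e.
Proof.
(* The base point supplies the default 1 beyond position d; the basis supplies positions 1, ...,
   d. *)
have combE r : seqval t 1 r = (d < r)%N%:R + comb (tnth t) r.
  rewrite /seqval size_tuple; have [h|h] := leqP r d; last first.
    by rewrite comb_out ?addr0 // h orbT.
  rewrite add0r; case: (posnP r) => [->|r0].
    by rewrite comb_out // nth_default // size_tuple subn0.
  rewrite (comb_in (T := fun r => nth 0 t (d - r))) ?r0 // => i.
  by rewrite subKn ?(ltnW (ltn_ord i)) // (tnth_nth 0).
rewrite comb_basis; case: e => [[e|e]|[e m]] /=; try case: ifP => _;
  by rewrite !combE ?posS_gtd ?posZ_gtd // opprD addrACA.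
Qed.

Lemma flow_polytope_chain_ok (t : d.-tuple R) :
  P (@flow_of k a R (fun l => seqval t 1 (posS l)) (fun j => seqval t 1 (posZ j)))
  <-> chain_ok k t 1 1.
Proof.
set S := fun l => _; set Z := fun j => _.
have S0 : S 0%N = 0 by rewrite /S posS0 seqval0.
have Z0 : Z 0%N = 0 by rewrite /Z posZ0 seqval0.
have S1 : S (k * a.+1)%N = 1.
  by rewrite /S seqval_default // size_tuple posS_gtd.
have Z1 : Z a.+1 = 1 by rewrite /Z seqval_default // size_tuple posZ_gtd.
have leS l : (posS l <= size t)%N = (l < k * a.+1)%N.
  by rewrite size_tuple leqNgt posS_gtd // -ltnNge.
have leZ j : (posZ j <= size t)%N = (j <= a)%N.
  by rewrite size_tuple leqNgt posZ_gtd // -ltnNge.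
rewrite flow_polytope_flow_of // flow_of_ge0 // chain_okP //.
split=> [[hS hZ hSZ]|[hS hZ]].
  have S_ge0 l : (l <= k * a.+1)%N -> 0 <= S l.
    elim: l => [|l IHl] hl; first by rewrite S0.
    exact: le_trans (IHl (ltnW hl)) (hS _ hl).
  split=> [l l0|j j0]; rewrite ?leS ?leZ => h.
    by rewrite -/(S l) -/(S l.+1) S_ge0 ?hS // ltnW.
  by rewrite -/(S (k * j)%N) -/(Z j) -/(Z j.+1) hSZ ?j0 // hZ.
have S_ge0 l : (l <= k * a.+1)%N -> 0 <= S l.
  case: (posnP l) => [->|l0]; first by rewrite S0.
  rewrite leq_eqVlt => /predU1P[->|h]; first by rewrite S1.
  by have := hS l l0; rewrite leS h => /(_ isT)/andP[].
split=> [l hl|j hj|j /andP[j0 ja]].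
- case: (posnP l) => [l0|l0]; first by rewrite l0 S0 S_ge0 // -l0.
  by have := hS l l0; rewrite leS hl => /(_ isT)/andP[].
- case: (posnP j) => [->|j0]; last first.
    by have := hZ j j0; rewrite leZ -ltnS hj => /(_ isT)/andP[].
  (* [chain_okP] does not list [0 <= Z_1]; it follows from the link [S_k <= Z_1], or from [Z_1 = 1]
     when [a = 0]. *)
  rewrite Z0; case: (posnP a) => [a0|a0]; first by rewrite -[1%N]/(0.+1) -a0 Z1.
  have := hZ 1%N isT; rewrite leZ a0 => /(_ isT)/andP[+ _].
  by apply: le_trans; apply: S_ge0; rewrite leq_pmul2l.
- by have := hZ j j0; rewrite leZ ja => /(_ isT)/andP[].
Qed.

End LatticeBasis.

(** * The normalized volume *)

Theorem theorem5p3 (R : realType) (k a : nat) (hk : (1 <= k)%N) (ha : (1 <= a)%N) :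
  has_normalized_volume
    (flow_polytope (G := MCar k a) (unit_netflow R (n := a)))
    (Cat R a (k * a - 1))%:E.
Proof.
case: a ha => // a _.
exists (k * a.+1 + a - 1)%N.
(* The base point has all free coordinates 0: the unit runs from 0 to 1 and then straight to the
   sink. *)
exists (@flow_of k a R (fun l => (k * a.+1 <= l)%N%:R) (fun j => (a.+1 <= j)%N%:R)).
exists (@basis_flow k a); split.
- apply: subset_affine_hull; apply: vertex_in_flow_polytope => //.
  + by rewrite leqnn muln_gt0 hk.
  + by rewrite leqnn.
  + by move=> j ja; rewrite leq_pmul2l //; lia.
- exact: lattice_basis_flow.
have -> : [set t : (k * a.+1 + a - 1).-tuple R |
    flow_polytope (G := MCar k a.+1) (unit_netflow R (n := a.+1)) (fun e =>
      @flow_of k a R (fun l => (k * a.+1 <= l)%N%:R) (fun j => (a.+1 <= j)%N%:R) e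
      + \sum_i tnth t i * (basis_flow i e)%:~R)] = [set t | chain_ok k t 1 1].
  apply/seteqP; split=> t /=; under eq_fun do rewrite flow_coordinates //;
  by move/flow_polytope_chain_ok; apply.
rewrite lebesgue_chain_ok //.
have ka : (0 < k * a.+1)%N by rewrite muln_gt0 hk.
(* Of the d free coordinates, a are Z-coordinates, as d + 1 = a (k + 1) + k. *)
have -> : ((k * a.+1 + a - 1).+1 %/ k.+1 = a)%N.
  have -> : ((k * a.+1 + a - 1).+1 = a * k.+1 + k)%N.
    by rewrite -subSn; lia.
  by rewrite divnMDl // divn_small // addn0.
have -> : (k * a.+1 + a - 1 - a = k * a.+1 - 1)%N by lia.
by rewrite -EFinM ballot_poly_Cat.
Qed.
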